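(* There exist a poset $P$ and a non-tame $P$-module $M$ whose Int-GRI $\mathrm{rk}_M^{\mathrm{Int}}$ is Möbius invertible.
   Context: Fix a field $k$; $\mathbf{vec}$ is the category of finite-dimensional $k$-vector spaces. A poset $P$ is regarded as a category. A $P$-module is a functor $M:P\to\mathbf{vec}$, with $M_p:=M(p)$ and $\varphi_M(p,q):=M(p\le q)$. An encoding of a $P$-module $M$ by a poset $Q$ is an order-preserving map $\pi:P\to Q$ together with a $Q$-module $N$ such that $M_p=N_{\pi(p)}$ and $\varphi_M(p,p')=\varphi_N(\pi(p),\pi(p'))$ for all $p\le p'$. The encoding is finite if $Q$ is finite. $M$ is tame if it admits a finite encoding. An interval of $P$ is a nonempty $I\subset P$ that is convex ($p,r\in I$, $p\le q\le r$ imply $q\in I$) and connected (any two elements of $I$ are joined by a finite sequence in $I$ whose consecutive elements are comparable). $\mathrm{Int}(P)$ is the set of intervals of $P$. For a connected poset $P$ and a $P$-module $M$, $\mathrm{rk}(M)$ is the rank of the canonical map $\varprojlim M\to\varinjlim M$, namely $i_p\circ\pi_p$ for any $p\in P$ ($\pi_p,i_p$ the structure maps). The Int-GRI of $M$ is $\mathrm{rk}_M^{\mathrm{Int}}:\mathrm{Int}(P)\to\mathbb Z_{\ge0}$, $I\mapsto \mathrm{rk}(M|_I)$. It is Möbius invertible if there exist $\mathcal I\subset\mathrm{Int}(P)$ and a map $d:\mathcal I\to\mathbb Z$ such that for every $I\in\mathrm{Int}(P)$, $\mathrm{rk}_M^{\mathrm{Int}}(I)=\sum_{J\supset I,\,J\in\mathcal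 I} d(J)$, where the sum has only finitely many nonzero summands. *)

(* Defs.v *)
From HB Require Import structures.
From mathcomp Require Import all_boot all_order all_algebra generic_quotient.
From mathcomp Require Import boolp classical_sets functions.
From mathcomp Require Import cardinality fsbigop.

Set Implicit Arguments.
Unset Strict Implicit.
Unset Printing Implicit Defensive.

Import Order.TTheory GRing.Theory.

Local Open Scope classical_set_scope.
Local Open Scope ring_scope.

(* [vectType k] is the type of finite-dimensional vector spaces over [k]. *)
Record pmodule (k : fieldType) (d : Order.disp_t) (P : porderType d) :=
  PModule {
    pm_obj :> P -> vectType k;
    pm_map : forall p q : P, (p <= q)%O -> 'Hom(pm_obj p, pm_obj q);
    pm_map_id : forall (p : P) (h : (p <= p)%O), pm_map h = \1%VF;
    pm_map_comp : forall (p q r : P) (hpq : (p <= q)%O) (hqr : (q <= r)%O)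
      (hpr : (p <= r)%O), pm_map hpr = (pm_map hqr \o pm_map hpq)%VF }.

Definition pm_iso (k : fieldType) (d : Order.disp_t) (P : porderType d)
    (M N : pmodule k P) : Prop :=
  exists f : forall p : P, 'Hom(M p, N p),
    (forall p, bijective (f p)) /\
    forall (p q : P) (h : (p <= q)%O) (x : M p),
      f q (pm_map M h x) = pm_map N h (f p x).

Definition pm_pullback (k : fieldType) (d d' : Order.disp_t)
    (P : porderType d) (Q : porderType d') (f : P -> Q)
    (hf : {homo f : x y / (x <= y)%O}) (N : pmodule k Q) : pmodule k P :=
  @PModule k d P (fun p => N (f p)) (fun p q h => pm_map N (hf p q h))
    (fun p h => pm_map_id N (hf p p h))
    (fun p q r hpq hqr hpr =>
       pm_map_comp N (hf p q hpq) (hf q r hqr) (hf p r hpr)).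

(* The defining equalities [M_p = N_{pi(p)}] and [M(p <= q) = N(pi p <= pi q)]
   are read as a natural isomorphism between [M] and the pullback of [N]: literal
   equality of the spaces would make tameness depend on the choice of
   representatives in an isomorphism class of modules. *)
Definition encoding (k : fieldType) (d d' : Order.disp_t) (P : porderType d)
    (Q : porderType d') (M : pmodule k P) (pi : P -> Q) (N : pmodule k Q) :=
  exists hpi : {homo pi : x y / (x <= y)%O}, pm_iso M (pm_pullback hpi N).

Definition tame (k : fieldType) (d : Order.disp_t) (P : porderType d)
    (M : pmodule k P) : Prop :=
  exists (d' : Order.disp_t) (Q : finPOrderType d') (pi : P -> Q)
    (N : pmodule k Q), encoding M pi N.

Section Intervals.
Variables (d : Order.disp_t) (P : porderType d).
Implicit Types I : set P.

Definition convex_set I : Prop :=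
  forall p q r : P, I p -> I r -> (p <= q <= r)%O -> I q.

Definition connected_set I : Prop :=
  forall p q : P, I p -> I q -> exists s : seq P,
    [/\ path (fun x y => (x >=< y)%O) p s, last p s = q
      & forall x, x \in s -> I x].

Definition is_interval I : Prop :=
  [/\ I !=set0, convex_set I & connected_set I].

End Intervals.

Definition pinterval (d : Order.disp_t) (P : porderType d) :=
  {I : set P | `[< is_interval I >]}.

HB.instance Definition _ (d : Order.disp_t) (P : porderType d) :=
  [isSub of pinterval P for sval].
HB.instance Definition _ (d : Order.disp_t) (P : porderType d) :=
  [Choice of pinterval P by <:].

Section Subposet.
Variables (d : Order.disp_t) (P : porderType d) (I : set P).

Definition subposet := set_type I.
HB.instance Definition _ := SubChoice.on subposet.
HB.instance Definition _ := [SubChoice_isSubPOrder of subposet by <: with d].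

Lemma subposet_homo : {homo (val : subposet -> P) : x y / (x <= y)%O}.
Proof. by move=> x y; rewrite -Order.le_val. Qed.

End Subposet.

Definition pm_restrict (k : fieldType) (d : Order.disp_t) (P : porderType d)
    (M : pmodule k P) (I : set P) : pmodule k (subposet I) :=
  pm_pullback (@subposet_homo d P I) M.

Definition pm_prod (k : fieldType) (d : Order.disp_t) (P : porderType d)
  (M : pmodule k P) := forall p : P, M p.

Section Product.
Variables (k : fieldType) (d : Order.disp_t) (P : porderType d).
Variable M : pmodule k P.
Local Notation prodM := (pm_prod M).

HB.instance Definition _ := Choice.on prodM.

Let add (f g : prodM) : prodM := fun p => f p + g p.
Let opp (f : prodM) : prodM := fun p => - f p.
Let scale (a : k) (f : prodM) : prodM := fun p => a *: f p.

Fact pm_prod_addA : associative add.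
Proof.
by move=> f g h; apply: functional_extensionality_dep => p; exact: addrA.
Qed.
Fact pm_prod_addC : commutative add.
Proof.
by move=> f g; apply: functional_extensionality_dep => p; exact: addrC.
Qed.
Fact pm_prod_add0 : left_id (fun p => 0 : M p) add.
Proof.
by move=> f; apply: functional_extensionality_dep => p; exact: add0r.
Qed.
Fact pm_prod_addN : left_inverse (fun p => 0 : M p) opp add.
Proof.
by move=> f; apply: functional_extensionality_dep => p; exact: addNr.
Qed.

HB.instance Definition _ :=
  GRing.isZmodule.Build prodM
    pm_prod_addA pm_prod_addC pm_prod_add0 pm_prod_addN.

Fact pm_prod_scaleA a b (f : prodM) : scale a (scale b f) = scale (a * b) f.
Proof. by apply: functional_extensionality_dep => p; exact: scalerA. Qed.
Fact pm_prod_scale1 : left_id 1 scale.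
Proof.
by move=> f; apply: functional_extensionality_dep => p; exact: scale1r.
Qed.
Fact pm_prod_scaleDr : right_distributive scale +%R.
Proof.
by move=> a f g; apply: functional_extensionality_dep => p; exact: scalerDr.
Qed.
Fact pm_prod_scaleDl f : {morph scale^~ f : a b / a + b}.
Proof.
by move=> a b; apply: functional_extensionality_dep => p; exact: scalerDl.
Qed.

HB.instance Definition _ :=
  GRing.Zmodule_isLmodule.Build k prodM
    pm_prod_scaleA pm_prod_scale1 pm_prod_scaleDr pm_prod_scaleDl.

Lemma pm_prod0E p : (0 : prodM) p = 0. Proof. by []. Qed.
Lemma pm_prodDE (f g : prodM) p : (f + g) p = f p + g p. Proof. by []. Qed.
Lemma pm_prodNE (f : prodM) p : (- f) p = - f p. Proof. by []. Qed.
Lemma pm_prodBE (f g : prodM) p : (f - g) p = f p - g p. Proof. by []. Qed.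
Lemma pm_prodZE a (f : prodM) p : (a *: f) p = a *: f p. Proof. by []. Qed.

End Product.

Section Limit.
Variables (k : fieldType) (d : Order.disp_t) (P : porderType d).
Variable M : pmodule k P.

Definition compatible_family : {pred pm_prod M} := fun f =>
  `[< forall (p q : P) (h : (p <= q)%O), pm_map M h (f p) = f q >].

Lemma compatible_family_closed : GRing.submod_closed compatible_family.
Proof.
split; first by apply/asboolP => p q h; rewrite linear0.
move=> a f g /asboolP cf /asboolP cg; apply/asboolP => p q h.
by rewrite !pm_prodDE !pm_prodZE linearD linearZ /= cf cg.
Qed.

HB.instance Definition _ :=
  GRing.isSubmodClosed.Build k (pm_prod M) compatible_family
    (GRing.submod_closed_semi compatible_family_closed).

Definition pm_lim := {f : pm_prod M | f \in compatible_family}.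
HB.instance Definition _ := SubChoice.on pm_lim.
HB.instance Definition _ := [SubChoice_isSubLmodule of pm_lim by <:].

Definition lim_proj (p : P) (f : pm_lim) : M p := val f p.

Lemma lim_proj_linear p : linear (lim_proj p).
Proof. by []. Qed.

HB.instance Definition _ p :=
  GRing.isLinear.Build k pm_lim (M p) *:%R (lim_proj p) (lim_proj_linear p).

End Limit.

Section Colimit.
Variables (k : fieldType) (d : Order.disp_t) (P : porderType d).
Variable M : pmodule k P.

Definition finite_family : {pred pm_prod M} := fun f =>
  `[< finite_set [set p | f p != 0] >].

Lemma finite_family_closed : GRing.submod_closed finite_family.
Proof.
split.
  apply/asboolP; apply: (@sub_finite_set _ _ set0) => // p /=.
  by rewrite eqxx.
move=> a f g /asboolP ff /asboolP fg; apply/asboolP.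
apply: (@sub_finite_set _ _ ([set p | f p != 0] `|` [set p | g p != 0])).
  move=> p /=; rewrite pm_prodDE pm_prodZE => h.
  have [f0|] := eqVneq (f p) 0; last by left.
  by right; move: h; rewrite f0 scaler0 add0r.
by rewrite finite_setU.
Qed.

HB.instance Definition _ :=
  GRing.isSubmodClosed.Build k (pm_prod M) finite_family
    (GRing.submod_closed_semi finite_family_closed).

Definition pm_dsum := {f : pm_prod M | f \in finite_family}.
HB.instance Definition _ := SubChoice.on pm_dsum.
HB.instance Definition _ := [SubChoice_isSubLmodule of pm_dsum by <:].

Lemma single_family_finite (p : P) (x : M p) :
  dfwith (0 : pm_prod M) x \in finite_family.
Proof.
apply/asboolP; apply: (@sub_finite_set _ _ [set p]) => // q /=.
by case: dfwithP => // r _; rewrite eqxx.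
Qed.

Definition dsum_inj (p : P) (x : M p) : pm_dsum :=
  Sub (dfwith (0 : pm_prod M) x) (single_family_finite x).

Lemma dsum_inj_linear p : linear (@dsum_inj p).
Proof.
move=> a x y; apply/val_inj => /=; apply: functional_extensionality_dep => q.
rewrite pm_prodDE pm_prodZE; have [<-|pq] := eqVneq p q.
  by rewrite !dfwith_in.
by rewrite !dfwith_out // scaler0 addr0.
Qed.

HB.instance Definition _ p :=
  GRing.isLinear.Build k (M p) pm_dsum *:%R (@dsum_inj p) (@dsum_inj_linear p).

(* The smallest submodule of the direct sum containing the elements
   [in_p x - in_q (M(p <= q) x)]. *)
Definition colim_relations : {pred pm_dsum} := fun u =>
  `[< forall S : submodClosed pm_dsum,
        (forall (p q : P) (h : (p <= q)%O) (x : M p),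
           dsum_inj x - dsum_inj (pm_map M h x) \in S) -> u \in S >].

Lemma colim_relations_closed : GRing.submod_closed colim_relations.
Proof.
split; first by apply/asboolP => S _; rewrite rpred0.
move=> a u v /asboolP hu /asboolP hv; apply/asboolP => S hS.
by rewrite rpredD ?rpredZ ?hu ?hv.
Qed.

HB.instance Definition _ :=
  GRing.isSubmodClosed.Build k pm_dsum colim_relations
    (GRing.submod_closed_semi colim_relations_closed).

Definition pm_colim := Quotient.quot colim_relations.
HB.instance Definition _ := ZmodQuotient.on pm_colim.

Local Open Scope quotient_scope.

Definition colim_scale (a : k) (x : pm_colim) : pm_colim :=
  \pi_pm_colim (a *: repr x).

Lemma colim_piP (u v : pm_dsum) :
  reflect (\pi_pm_colim u = \pi_pm_colim v) (u - v \in colim_relations).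
Proof. by rewrite Quotient.idealrBE; apply: eqP. Qed.

Lemma colim_piD (u v : pm_dsum) :
  \pi_pm_colim (u + v) = \pi_pm_colim u + \pi_pm_colim v.
Proof. exact: Quotient.pi_add. Qed.

Lemma colim_pi_scale (a : k) (u : pm_dsum) :
  colim_scale a (\pi_pm_colim u) = \pi_pm_colim (a *: u).
Proof.
apply/colim_piP; rewrite -scalerBr rpredZ //; apply/colim_piP.
by rewrite reprK.
Qed.

Fact colim_scaleA a b x :
  colim_scale a (colim_scale b x) = colim_scale (a * b) x.
Proof.
by elim/quotW: x => u; rewrite (colim_pi_scale b) !colim_pi_scale scalerA.
Qed.
Fact colim_scale1 : left_id 1 colim_scale.
Proof. by elim/quotW=> u; rewrite colim_pi_scale scale1r. Qed.
Fact colim_scaleDr : right_distributive colim_scale +%R.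
Proof.
move=> a; elim/quotW=> u; elim/quotW=> v.
by rewrite -colim_piD !colim_pi_scale -colim_piD -scalerDr.
Qed.
Fact colim_scaleDl x : {morph colim_scale^~ x : a b / a + b}.
Proof.
by move=> a b; elim/quotW: x => u; rewrite !colim_pi_scale -colim_piD -scalerDl.
Qed.

HB.instance Definition _ :=
  GRing.Zmodule_isLmodule.Build k pm_colim
    colim_scaleA colim_scale1 colim_scaleDr colim_scaleDl.

Definition colim_inj (p : P) (x : M p) : pm_colim :=
  \pi_pm_colim (dsum_inj x).

Lemma colim_inj_linear p : linear (@colim_inj p).
Proof.
move=> a x y; by rewrite /colim_inj linearP colim_piD -colim_pi_scale.
Qed.

HB.instance Definition _ p :=
  GRing.isLinear.Build k (M p) pm_colim *:%R (@colim_inj p)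
    (@colim_inj_linear p).

Lemma colim_inj_map (p q : P) (h : (p <= q)%O) (x : M p) :
  colim_inj (pm_map M h x) = colim_inj x.
Proof. by apply/esym/colim_piP/asboolP => S; apply. Qed.

End Colimit.

Section LimitToColimit.
Variables (k : fieldType) (d : Order.disp_t) (P : porderType d).
Variable M : pmodule k P.

Lemma lim_proj_map (p q : P) (h : (p <= q)%O) (f : pm_lim M) :
  pm_map M h (lim_proj p f) = lim_proj q f.
Proof. exact: (asboolP _ (valP f)). Qed.

Definition lim_to_colim (p : P) : pm_lim M -> pm_colim M :=
  @colim_inj k d P M p \o @lim_proj k d P M p.

HB.instance Definition _ p := GRing.Linear.on (lim_to_colim p).

Lemma lim_to_colim_path (p : P) (s : seq P) :
  path (fun x y => (x >=< y)%O) p s ->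
  lim_to_colim p =1 lim_to_colim (last p s).
Proof.
elim: s p => //= q s ih p /andP[pq /ih e] f; rewrite -e {e ih}.
rewrite /lim_to_colim /=; case/orP: pq => h.
  by rewrite -(lim_proj_map h) colim_inj_map.
by rewrite -(lim_proj_map h) colim_inj_map.
Qed.

Lemma lim_to_colim_indep (p q : P) :
  connected_set [set: P] -> lim_to_colim p =1 lim_to_colim q.
Proof. by move=> /(_ p q I I)[s [/lim_to_colim_path + <- _]]. Qed.

End LimitToColimit.

Arguments lim_to_colim {k d P} M p.

Definition free_family (k : fieldType) (V : lmodType k) (n : nat)
    (b : 'I_n -> V) : Prop :=
  forall a : 'I_n -> k, \sum_i a i *: b i = 0 -> forall i, a i = 0.

Definition basis_of_set (k : fieldType) (V : lmodType k) (S : set V) (n : nat)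
    (b : 'I_n -> V) : Prop :=
  [/\ forall i, S (b i), free_family b
    & forall v, S v -> exists a : 'I_n -> k, v = \sum_i a i *: b i].

Definition has_dim (k : fieldType) (V : lmodType k) (S : set V) (n : nat) :=
  exists b : 'I_n -> V, basis_of_set S b.

(* The dimension of the image of [f], with the default value 0 when this image
   is not finite-dimensional; see [has_dim_unique] and
   [lim_to_colim_rankP]. *)
Definition lm_rank (k : fieldType) (U V : lmodType k) (f : U -> V) : nat :=
  xget 0%N [set n | has_dim (range f) n].

Lemma has_dim_le (k : fieldType) (V : lmodType k) (S : set V) (n m : nat)
    (b : 'I_n -> V) :
  free_family b -> (forall i, S (b i)) -> has_dim S m -> (n <= m)%N.
Proof.
move=> bfree Sb [c [_ _ cspan]].
have /choice[A bE] i := cspan _ (Sb i).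
pose X : 'M[k]_(n, m) := \matrix_(i, j) A i j.
rewrite -[X in (X <= _)%N](_ : \rank X = n); first exact: rank_leq_col.
apply/eqP; rewrite -/(row_free X) -kermx_eq0; apply/eqP/row_matrixP => l.
rewrite row0; set u := row l _.
have uX : u *m X = 0 by apply/eqP; rewrite -sub_kermx row_sub.
apply/rowP => i; rewrite [RHS]mxE; apply: (bfree (u 0)).
under eq_bigr => j _ do rewrite bE scaler_sumr.
rewrite exchange_big /= big1 // => j _.
under eq_bigr => i0 _ do rewrite scalerA.
rewrite -scaler_suml.
have -> : \sum_(i0 < n) u 0 i0 * A i0 j = 0; last by rewrite scale0r.
transitivity ((u *m X) 0 j); last by rewrite uX mxE.
by rewrite mxE; apply: eq_bigr => i0 _; rewrite [X in _ = _ * X]mxE.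
Qed.

Lemma has_dim_unique (k : fieldType) (V : lmodType k) (S : set V) (n m : nat) :
  has_dim S n -> has_dim S m -> n = m.
Proof.
move=> hn hm; apply/eqP; rewrite eqn_leq.
have [b [Sb bf _]] := hn; have [c [Sc cf _]] := hm.
by rewrite (has_dim_le bf Sb hm) (has_dim_le cf Sc hn).
Qed.

Lemma has_dim_range (k : fieldType) (U V : lmodType k) (W : vectType k)
    (g : {linear U -> W}) (h : {linear W -> V}) :
  exists n, has_dim (range (h \o g)) n.
Proof.
set S := range _.
have SP (a : k) u v : S u -> S v -> S (a *: u + v).
  by move=> [x _ <-] [y _ <-]; exists (a *: x + y) => //=; rewrite !linearP.
have bound n (b : 'I_n -> V) :
    (forall i, S (b i)) -> free_family b -> (n <= \dim {:W})%N.
  move=> Sb bf.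
  have /choice[w wb] i : exists w, h w = b i.
    by have [x _ <-] := Sb i; exists (g x).
  pose X := [tuple w i | i < n].
  suff : free X.
    by rewrite /free size_tuple => /eqP <-; rewrite dimvS ?subvf.
  apply/freeP => a; move=> e i; apply: bf.
  rewrite -[RHS](linear0 h) -e linear_sum; apply: eq_bigr => j _.
  rewrite linearZ -wb; congr (_ *: h _).
  by rewrite (nth_map j) ?size_enum_ord // nth_ord_enum.
pose P n := `[< exists b : 'I_n -> V, (forall i, S (b i)) /\ free_family b >].
have P0 : exists n, P n.
  exists 0%N; apply/asboolP; exists (fun=> 0); split; first by case.
  by move=> a _ [].
have Pb n : P n -> (n <= \dim {:W})%N by move=> /asboolP[b []]; exact: bound.
case: (ex_maxnP P0 Pb) => n /asboolP[b [Sb bf]] nmax.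
exists n, b; split => // v Sv.
apply: contrapT => vb.
suff /nmax : P n.+1 by rewrite ltnn.
apply/asboolP.
pose b' (i : 'I_n.+1) := if unlift ord0 i is Some j then b j else v.
exists b'; split; first by rewrite /b' => i; case: unliftP.
move=> a; rewrite big_ord_recl {1}/b' unlift_none.
under eq_bigr => i _ do rewrite /b' liftK.
move=> e; have a0 : a ord0 = 0.
  apply/eqP; apply: contra_notT vb => a0.
  exists (fun i => - (a ord0)^-1 * a (lift ord0 i)).
  under eq_bigr => i _ do rewrite -scalerA.
  rewrite -scaler_sumr; move/eqP: e; rewrite addrC addr_eq0 => /eqP ->.
  by rewrite scaleNr scalerN opprK scalerA mulVf ?scale1r.
move: e; rewrite a0 scale0r add0r => /bf ai i.
by case: (unliftP ord0 i) => [j|] ->.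
Qed.

Lemma lim_to_colim_rankP (k : fieldType) (d : Order.disp_t) (P : porderType d)
    (M : pmodule k P) (p : P) :
  has_dim (range (lim_to_colim M p)) (lm_rank (lim_to_colim M p)).
Proof.
have [n hn] := has_dim_range (@lim_proj k d P M p) (@colim_inj k d P M p).
exact: (xgetPex 0%N (ex_intro _ n hn)).
Qed.

Lemma pinterval_neq0 (d : Order.disp_t) (P : porderType d)
    (I : pinterval P) : exists p : P, p \in sval I.
Proof. by have /asboolP[[p Ip] _ _] := svalP I; exists p; apply/mem_set. Qed.

(* An arbitrary element; the choice is irrelevant by [int_griE]. *)
Definition pinterval_point (d : Order.disp_t) (P : porderType d)
    (I : pinterval P) : subposet (sval I) :=
  let: exist p Ip := cid (pinterval_neq0 I) in exist _ p Ip.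

Definition int_gri (k : fieldType) (d : Order.disp_t) (P : porderType d)
    (M : pmodule k P) (I : pinterval P) : nat :=
  lm_rank (lim_to_colim (pm_restrict M (sval I)) (pinterval_point I)).

Lemma subposet_connected (d : Order.disp_t) (P : porderType d) (I : set P) :
  connected_set I -> connected_set [set: subposet I].
Proof.
move=> cI p q _ _.
have [s [ps pq sI]] := cI _ _ (set_mem (valP p)) (set_mem (valP q)).
elim: s p ps pq sI => [|r s ih] p /=.
  by move=> _ /val_inj -> _; exists [::].
move=> /andP[pr rs] rq sI.
have Ir : r \in I by apply/mem_set/sI; rewrite mem_head.
have [|//||t [pt tq _]] := ih (exist _ r Ir : subposet I).
- exact: rs.
- by move=> x xs; apply: sI; rewrite in_cons xs orbT.
exists ((exist _ r Ir : subposet I) :: t); split => //=.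
by rewrite pt andbT; move: pr; rewrite !/(_ >=< _)%O -!Order.le_val.
Qed.

Lemma int_griE (k : fieldType) (d : Order.disp_t) (P : porderType d)
    (M : pmodule k P) (I : pinterval P) (p : subposet (sval I)) :
  int_gri M I = lm_rank (lim_to_colim (pm_restrict M (sval I)) p).
Proof.
have /asboolP[_ _ /subposet_connected cI] := svalP I.
rewrite /int_gri; congr lm_rank; apply/funext => f.
exact: lim_to_colim_indep.
Qed.

Definition mobius_invertible (k : fieldType) (d : Order.disp_t)
    (P : porderType d) (M : pmodule k P) : Prop :=
  exists (A : set (pinterval P)) (g : set_type A -> int),
    forall I : pinterval P,
      let above := [set J : set_type A | sval I `<=` sval (val J)] in
      finite_set [set J | above J /\ g J != 0] /\
      (int_gri M I)%:Z = \sum_(J \in above) g J.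

(* Main.v *)
(* On the chain of natural numbers let M_n = k^n, with all maps M_p -> M_q,
   p < q, equal to zero. The dimensions of M are unbounded, whereas a finite
   encoding allows only finitely many, so M is not tame.
   Its Int-GRI vanishes on every interval with at least two points, hence on
   every interval strictly containing another one, so it is its own Mobius
   inverse. *)

Require Import Defs.
From mathcomp Require Import all_boot all_order all_algebra.
From mathcomp Require Import boolp classical_sets functions cardinality fsbigop.

Set Implicit Arguments.
Unset Strict Implicit.
Unset Printing Implicit Defensive.

Import Order.TTheory GRing.Theory.

Local Open Scope classical_set_scope.
Local Open Scope ring_scope.

Lemma linear_bij_dim (k : fieldType) (U V : vectType k) (f : 'Hom(U, V)) :
  bijective f -> \dim {:U} = \dim {:V}.
Proof.
move=> [g fK gK]; have kerf : lker f == 0%VS by apply/lker0P; exact: can_inj fK.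
rewrite -(limg_dim_eq (f := f)) ?(eqP kerf) ?capv0 //.
congr (\dim _); apply/eqP; rewrite eqEsubv subvf; apply/subvP => v _.
by rewrite -[v]gK memv_img ?memvf.
Qed.

(** Each [M p] is isomorphic to one of the finitely many spaces [N q], so their largest dimension
    serves as the bound. *)
Lemma tame_dim_bounded (k : fieldType) (d : Order.disp_t) (P : porderType d)
    (M : pmodule k P) :
  tame M -> exists b : nat, forall p, (\dim {:M p} <= b)%N.
Proof.
move=> [d' [Q [pi [N [hpi [f [fbij _]]]]]]].
exists (\max_q \dim {:N q}) => p.
by rewrite (linear_bij_dim (fbij p)); exact: (leq_bigmax (pi p)).
Qed.

Lemma lm_rank_eq0 (k : fieldType) (U V : lmodType k) (f : U -> V) :
  f =1 (fun=> 0) -> lm_rank f = 0%N.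
Proof.
move=> f0; have dim0 : has_dim (range f) 0.
  exists (fun=> 0); split; [by case | by move=> a _ [] |].
  by move=> _ [x _ <-]; exists (fun=> 0); rewrite f0 big_ord0.
(* [xget] returns some dimension of the range; uniqueness of dimension identifies it with 0. *)
exact: has_dim_unique (xgetPex 0%N (ex_intro _ 0%N dim0)) dim0.
Qed.

(** The rank may be computed at [q], where a compatible family takes the image of its value at [p]
    under the zero map. *)
Lemma int_gri_eq0 (k : fieldType) (d : Order.disp_t) (P : porderType d)
    (M : pmodule k P) (I : pinterval P) (p q : P) (pq : (p <= q)%O) :
  sval I p -> sval I q -> pm_map M pq = 0 -> int_gri M I = 0%N.
Proof.
move=> Ip Iq M0.
pose p' : subposet (sval I) := exist _ p (mem_set Ip).
pose q' : subposet (sval I) := exist _ q (mem_set Iq).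
have pq' : (p' <= q')%O by [].
rewrite (int_griE M q'); apply: lm_rank_eq0 => x.
rewrite /lim_to_colim /= -(lim_proj_map pq') /=.
(* The restricted module carries its own proof of [p <= q]. *)
by rewrite (Prop_irrelevance (subposet_homo pq') pq) M0 zero_lfunE linear0.
Qed.

(** Taking the Int-GRI itself as the coefficients, only the term [J = I] of the sum over [J]
    containing [I] can survive. *)
Lemma mobius_invertible_vanishing (k : fieldType) (d : Order.disp_t)
    (P : porderType d) (M : pmodule k P) :
  (forall I J : pinterval P, sval I `<=` sval J -> I != J -> int_gri M J = 0%N) ->
  mobius_invertible M.
Proof.
move=> M0; exists [set: pinterval P], (fun J => (int_gri M (val J))%:Z) => I above.
pose I' : set_type [set: pinterval P] := exist _ I (mem_set Logic.I).
have aboveP J : above J -> (int_gri M (val J))%:Z != 0 -> J = I'.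
  move=> IJ; have [//|neq] := eqVneq J I'.
  rewrite (M0 I) ?eqxx //; apply: contra neq => /eqP e.
  by apply/eqP/val_inj.
split; first by apply: (sub_finite_set (B := [set I'])) => // J []; exact: aboveP.
rewrite -(fsbig_widen [set I']) ?fsbig_set1 //; first by move=> _ ->.
move=> J [IJ JI]; apply/eqP; apply: contra_notT JI; exact: aboveP.
Qed.

Section StrictZeroModule.
Variable k : fieldType.

(** The rectangular [pid_mx p] is the identity matrix when [p = q], which avoids a transport along
    that equality. *)
Definition strict_zero_mx (p q : nat) : 'M[k]_(p, q) :=
  if p == q then pid_mx p else 0.

Definition strict_zero_map (p q : nat) : 'Hom('rV[k]_p, 'rV[k]_q) :=
  linfun (mulmxr (strict_zero_mx p q)).

Lemma strict_zero_map_id p : strict_zero_map p p = \1%VF.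
Proof.
by apply/lfunP => x; rewrite lfunE /= id_lfunE /strict_zero_mx eqxx pid_mx_1 mulmx1.
Qed.

Lemma strict_zero_map_neq p q : p != q -> strict_zero_map p q = 0.
Proof.
move=> /negPf pq; apply/lfunP => x.
by rewrite lfunE /= /strict_zero_mx pq mulmx0 zero_lfunE.
Qed.

Lemma strict_zero_map_comp (p q r : nat) : (p <= q)%O -> (q <= r)%O ->
  strict_zero_map p r = (strict_zero_map q r \o strict_zero_map p q)%VF.
Proof.
have [<-|pq] := eqVneq p q; first by rewrite strict_zero_map_id comp_lfun1r.
move=> le_pq le_qr; rewrite (strict_zero_map_neq pq) comp_lfun0r.
(* Antisymmetry excludes [p = r], where the left side would be the identity. *)
apply: strict_zero_map_neq; apply: contra pq => /eqP pr.
by rewrite eq_le le_pq pr.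
Qed.

Definition strict_zero_module : pmodule k nat :=
  @PModule k _ nat (fun p => 'rV[k]_p) (fun p q _ => strict_zero_map p q)
    (fun p _ => strict_zero_map_id p)
    (fun p q r pq qr _ => strict_zero_map_comp pq qr).

Lemma strict_zero_module_not_tame : ~ tame strict_zero_module.
Proof.
move=> /tame_dim_bounded[b /(_ b.+1)].
by rewrite dimvf /dim /= mul1n ltnn.
Qed.

Lemma strict_zero_module_mobius_invertible :
  mobius_invertible strict_zero_module.
Proof.
apply: mobius_invertible_vanishing => I J IJ neqIJ.
have /asboolP[[p Ip] _ _] := svalP I.
(* Otherwise [J] would be the singleton of [p], hence equal to [I]. *)
have [q Jq neq] : exists2 q, sval J q & q != p.
  apply: contrapT => noq; case/negP: neqIJ; apply/eqP/val_inj/seteqP; split=> //.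
  move=> q Jq; have [->//|neq] := eqVneq q p.
  by case: noq; exists q.
have Jp := IJ _ Ip.
(* The order is total, so a zero map joins [p] and [q] in one direction or the other. *)
case: (ltgtP p q) neq => // lt _.
- apply: (int_gri_eq0 (pq := ltW lt)) => //=.
  by apply: strict_zero_map_neq; rewrite lt_eqF.
- apply: (int_gri_eq0 (pq := ltW lt)) => //=.
  by apply: strict_zero_map_neq; rewrite lt_eqF.
Qed.

End StrictZeroModule.

Theorem proposition3p7 (k : fieldType) :
  exists (d : Order.disp_t) (P : porderType d) (M : pmodule k P),
    ~ tame M /\ mobius_invertible M.
Proof.
exists _, _, (strict_zero_module k); split.
  exact: strict_zero_module_not_tame.
exact: strict_zero_module_mobius_invertible.
Qed.
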